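(* Let $G$ be a torsion-free group which is locally center-by-finite. Then the proper power graph $P^*(G)$ is connected if and only if $G$ is isomorphic to a subgroup of the additive group $\mathbb{Q}$ of rational numbers.
   Context: The power graph of a group $G$ is here the undirected graph with vertex set $G$ in which two distinct elements $x,y$ are adjacent if and only if one of them is a power of the other (i.e. $y=x^k$ or $x=y^k$ for some integer $k$, which may be negative). The proper power graph $P^*(G)$ is its induced subgraph on $G\setminus\{1\}$. When $G$ is trivial, $P^*(G)$ is the empty graph, which is regarded as connected. A group $G$ is torsion-free if every non-identity element has infinite order. A group $G$ is locally center-by-finite if for every finite subset $X$ of $G$, the index $[\langle X\rangle : Z(\langle X\rangle)]$ is finite, where $Z$ denotes the center. *)

(* Defs.v *)
From HB Require Import structures.
From mathcomp Require Import all_boot all_algebra all_classical.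

Set Implicit Arguments.
Unset Strict Implicit.
Unset Printing Implicit Defensive.

Local Open Scope group_scope.
Local Open Scope classical_set_scope.

Record simple_graph := SimpleGraph {
  vertex :> Type;
  adj : vertex -> vertex -> Prop;
  adj_sym : forall x y, adj x y -> adj y x;
  adj_irrefl : forall x, ~ adj x x
}.

Fact induced_sym (X : simple_graph) (A : set X) (x y : A) :
  adj (val x) (val y) -> adj (val y) (val x).
Proof. exact: adj_sym. Qed.

Fact induced_irrefl (X : simple_graph) (A : set X) (x : A) :
  ~ adj (val x) (val x).
Proof. exact: adj_irrefl. Qed.

Definition induced_subgraph (X : simple_graph) (A : set X) : simple_graph :=
  SimpleGraph (@induced_sym X A) (@induced_irrefl X A).

Inductive walk (X : simple_graph) (x : X) : X -> Prop :=
| walk_nil : walk x x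
| walk_rcons y z : walk x y -> adj y z -> walk x z.

(* There is no non-emptiness requirement: the empty graph is connected. *)
Definition connected_graph (X : simple_graph) : Prop :=
  forall x y : X, walk x y.

Section Groups.
Variable G : groupType.

Definition expgz (x : G) (k : int) : G :=
  match k with Posz n => x ^+ n | Negz n => x ^- n.+1 end.

Definition is_power_of (y x : G) : Prop := exists k : int, y = expgz x k.

Definition power_adj (x y : G) : Prop :=
  x <> y /\ (is_power_of y x \/ is_power_of x y).

Fact power_adj_sym x y : power_adj x y -> power_adj y x.
Proof. by case=> neq pow; split; [exact: nesym | case: pow; [right | left]]. Qed.

Fact power_adj_irrefl x : ~ power_adj x x.
Proof. by case. Qed.

Definition power_graph : simple_graph :=
  SimpleGraph power_adj_sym power_adj_irrefl.

Definition proper_power_graph : simple_graph :=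
  @induced_subgraph power_graph [set x : G | x <> 1].

Definition torsion_free : Prop :=
  forall x : G, x <> 1 -> forall n : nat, (0 < n)%N -> x ^+ n <> 1.

Definition is_subgroup (H : set G) : Prop := group_closed [in H].

Definition generated (X : set G) : set G := smallest is_subgroup X.

Definition center_of (H : set G) : set G :=
  [set z | H z /\ forall x, H x -> commute z x].

Definition left_cosets (H K : set G) : set (set G) :=
  [set [set x * k | k in K] | x in H].

Definition finite_index (H K : set G) : Prop := finite_set (left_cosets H K).

Definition locally_center_by_finite : Prop :=
  forall X : set G, finite_set X ->
    finite_index (generated X) (center_of (generated X)).

End Groups.

Definition isomorphic_to_subgroup (G K : groupType) : Prop :=
  exists (H : set K) (f : {multiplicative G -> K}),
    is_subgroup H /\ set_bij [set: G] H f.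

(* [Algebra.to_multiplicative] turns the additive group of a zmodType into a groupType
   whose product is the addition. *)
Definition additive_rat : groupType := Algebra.to_multiplicative rat.

(* Main.v *)
From HB Require Import structures.
Require Import Defs.
From mathcomp Require Import all_boot all_algebra all_classical.

(** Two non-identity elements that are adjacent in the power graph have a
    common non-trivial power, and in a torsion-free group this commensurability
    is transitive.  Hence, if the proper power graph is connected and [u] is a
    non-identity element, every [y] satisfies [y^b = u^a] for some integers
    [b <> 0] and [a], and the ratio [a / b], the slope of [y], depends on [y]
    only.  The slope should be the embedding of the group in the rationals.  Its
    kernel is trivial by torsion-freeness, and it is clearly additive on pairs
    of commuting elements ([has_slopeM]); the difficulty is additivity on a pair
    [x], [y] that is not known to commute.

    This is where the finite index of the center [Z] of [H = <x, y>] enters.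
    The slope is a homomorphism on [Z], so it can be composed with the transfer
    from [H] to [Z].  The result is a homomorphism [t] from [H] to the rationals
    with [t z = n * slope z] for [z] in [Z], where [n] is the index of [Z]
    ([transfer]).  Every [h] in [H] has a positive power in [Z]
    ([finite_index_expg]), and both [t] and the slope turn powers into multiples, so [t h = n * slope h] on
    all of [H].  Since [t] is additive, so is the slope ([slope_morphism]);
    commutativity of the group is then a consequence of the embedding.

    Conversely, any two non-zero rationals have a common non-zero integer
    multiple ([rat_cross_multiple]).  If the group embeds in the rationals, two
    non-identity elements therefore have a common non-identity power, which is a
    middle vertex of a walk from one to the other. *)

Set Implicit Arguments.
Unset Strict Implicit.
Unset Printing Implicit Defensive.

Import GRing.Theory Num.Theory.

Local Open Scope group_scope.
Local Open Scope classical_set_scope.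

(** * Integer powers *)

Section IntegerPowers.
Variable G : groupType.
Implicit Types (x y : G) (a b k : int).

(** Since every integer is a difference of naturals, this reduces the laws of
    integer exponents to those of natural exponents without a case analysis on
    signs. *)
Lemma expgz_subn x m n : expgz x (m%:Z - n%:Z)%R = x ^+ m / x ^+ n.
Proof.
have [le_nm|lt_mn] := leqP n m; first by rewrite subzn //= expgnFr.
rewrite -opprB subzn ?(ltnW lt_mn) // -[LHS]invgK -[RHS]invgK invgF.
rewrite -expgnFr ?(ltnW lt_mn) //.
by case: (n - m)%N => [|d] //=; rewrite ?invg1 ?invgK.
Qed.

Lemma expgzD x a b : expgz x (a + b)%R = expgz x a * expgz x b.
Proof.
have diff k : exists m n : nat, k = (m%:Z - n%:Z)%R.
  case: k => n; first by exists n, 0%N; rewrite subr0.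
  by exists 0%N, n.+1; rewrite NegzE sub0r.
have [m [n ->]] := diff a; have [p [q ->]] := diff b.
rewrite addrACA -opprD -!PoszD !expgz_subn !expgnDr invgM -!mulgA; congr (_ * _).
have cX i j : commute (x ^+ i) (x ^+ j) by apply: commuteX2.
rewrite mulgA; apply: commuteV; apply: commute_sym; apply: commuteM => //.
exact: commuteV.
Qed.

Lemma expgzN x a : expgz x (- a)%R = (expgz x a)^-1.
Proof. by apply: (mulgI (expgz x a)); rewrite -expgzD subrr mulgV. Qed.

Lemma expgzM x a b : expgz x (a * b)%R = expgz (expgz x a) b.
Proof.
have natM n : expgz x (a * n%:Z)%R = expgz x a ^+ n.
  elim: n => [|n IHn]; first by rewrite mulr0.
  by rewrite intS mulrDr mulr1 expgzD IHn expgS.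
by case: b => n; rewrite ?NegzE ?mulrN ?expgzN natM.
Qed.

Lemma expgzMl x y a : commute x y -> expgz (x * y) a = expgz x a * expgz y a.
Proof.
move=> cxy; case: a => n; rewrite ?NegzE ?expgzN /= expgMn //.
by rewrite (commuteX2 _ _ cxy) invgM.
Qed.

Lemma torsion_free_expgz x k :
  torsion_free G -> expgz x k = 1 -> k != 0%R -> x = 1.
Proof.
move=> tfG xk1 k0; apply: contrapT => x1; case: k k0 xk1 => n n0 /=.
  by apply: tfG; rewrite ?lt0n.
by move=> xn1; apply: (tfG _ x1 n.+1) => //; rewrite -[LHS]invgK xn1 invg1.
Qed.

End IntegerPowers.

(** * Subgroups and cosets *)

Section Subgroups.
Variable G : groupType.
Implicit Types (H K : set G).

Lemma is_subgroupP H : is_subgroup H ->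
  [/\ H 1, forall x y, H x -> H y -> H (x * y) & forall x, H x -> H x^-1].
Proof.
move=> sH; have HV := group_closedV sH; have HM := group_closedM sH.
case: sH; rewrite inE => H1 _; split=> // [x y Hx Hy|x Hx]; apply/set_mem.
  by apply: HM; apply: mem_set.
by apply: HV; apply: mem_set.
Qed.

Lemma is_subgroupI H : H 1 -> (forall x y, H x -> H y -> H (x * y)) ->
  (forall x, H x -> H x^-1) -> is_subgroup H.
Proof.
move=> H1 HM HV; split; first exact: mem_set.
by move=> x y /set_mem Hx /set_mem Hy; apply/mem_set/HM/HV.
Qed.

Lemma generated_subgroup (X : set G) : is_subgroup (generated X).
Proof.
apply: is_subgroupI => [|x y Hx Hy|x Hx] K [sK XK];
  have [K1 KM KV] := is_subgroupP sK => //.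
  by apply: KM; [apply: Hx | apply: Hy].
by apply: KV; apply: Hx.
Qed.

Lemma center_of_subgroup H : is_subgroup H -> is_subgroup (center_of H).
Proof.
case/is_subgroupP=> H1 HM HV; apply: is_subgroupI.
- by split=> // x _; apply/commute_sym/commute1.
- move=> x y [Hx Zx] [Hy Zy]; split; first exact: HM.
  move=> z Hz; apply/commute_sym/commuteM; apply/commute_sym; first exact: Zx.
  exact: Zy.
- move=> x [Hx Zx]; split; first exact: HV.
  by move=> z Hz; apply/commute_sym/commuteV/commute_sym/Zx.
Qed.

Lemma subgroup_expgn H x n : is_subgroup H -> H x -> H (x ^+ n).
Proof.
case/is_subgroupP=> H1 HM _ Hx; elim: n => [|n IHn] //.
by rewrite expgS; apply: HM.
Qed.

Lemma lcoset_eq K x y : is_subgroup K ->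
  ([set x * k | k in K] = [set y * k | k in K]) <-> K (x^-1 * y).
Proof.
case/is_subgroupP=> K1 KM KV; split=> [eqK|Kxy].
  have: [set y * k | k in K] y by exists 1; rewrite ?mulg1.
  by rewrite -eqK => -[k Kk <-]; rewrite mulKg.
apply/seteqP; split=> _ [k Kk <-].
  exists ((x^-1 * y)^-1 * k); first by apply: KM => //; apply: KV.
  by rewrite invgM invgK !mulgA mulgV mul1g.
by exists (x^-1 * y * k); [apply: KM | rewrite !mulgA mulgV mul1g].
Qed.

(** By the pigeonhole principle two of the cosets [h^i K] coincide, say for
    [i < j], and then [h^(j - i)] lies in [K]. *)
Lemma finite_index_expg H K h : is_subgroup H -> is_subgroup K ->
  finite_index H K -> H h -> exists2 m, (0 < m)%N & K (h ^+ m).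
Proof.
move=> sH sK finHK Hh; apply: contrapT => noK; apply: infinite_nat.
pose c n := [set h ^+ n * k | k in K].
have c_lt i j : c i = c j -> (i < j)%N -> False.
  move=> /(lcoset_eq _ _ sK) Kij lt_ij; apply: noK.
  exists (j - i)%N; first by rewrite subn_gt0.
  by rewrite -(subnKC (ltnW lt_ij)) expgnDr mulKg in Kij.
have -> : [set: nat] = c @^-1` left_cosets H K.
  apply/seteqP; split=> // n _.
  by exists (h ^+ n); first exact: subgroup_expgn.
apply: finite_preimage => // i j _ _ cij.
by case: (ltngtP i j) => // [/(c_lt _ _ cij)|/(c_lt _ _ (esym cij))].
Qed.

End Subgroups.

(** * The transfer to the center *)

(** The transfer to the center, composed with a homomorphism [s] from the center
    to an additive group, so that the product over the cosets becomes a
    commutative sum.  Let [r C] be a representative of the coset [C].  For [h] in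
    [H], the elements [h * r C] and [r (h C)] differ by a factor [d h C] in the
    center, and [t h] is the sum of the [s (d h C)].  Additivity of [t] is the
    cocycle identity for [d], summed after reindexing along the permutation
    [C |-> h C].  A central [z] fixes all cosets and has [d z C = z], which makes
    [n] the index of the center. *)
Lemma transfer (G : groupType) (H : set G) (A : zmodType) (s : G -> A) :
  is_subgroup H -> finite_index H (center_of H) ->
  (forall y z, center_of H y -> center_of H z -> s (y * z) = (s y + s z)%R) ->
  exists (t : G -> A) (n : nat), [/\ (0 < n)%N,
    forall g h, H g -> H h -> t (g * h) = (t g + t h)%R &
    forall z, center_of H z -> t z = (s z *+ n)%R].
Proof.
move=> sH finZ sM; set Z := center_of H in finZ sM *.
have sZ : is_subgroup Z by exact: center_of_subgroup.
have [H1 HM HV] := is_subgroupP sH; have [Z1 ZM ZV] := is_subgroupP sZ.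
pose cos x := [set x * k | k in Z]; pose r C := xget (1 : G) C.
have cosP C : left_cosets H Z C -> H (r C) /\ cos (r C) = C.
  case=> x Hx <-{C}; have : cos x (r (cos x)).
    by apply: (@xgetPex _ 1); exists x, 1; rewrite ?mulg1.
  move: (r _) => _ [k Zk <-]; split; first by apply: HM => //; case: Zk.
  by apply/(lcoset_eq _ _ sZ); rewrite invgM mulgVK; apply: ZV.
pose act h C := cos (h * r C).
have actP h C : H h -> left_cosets H Z C -> left_cosets H Z (act h C).
  by move=> Hh /cosP[Hr _]; exists (h * r C); first exact: HM.
have actM g h C :
    H g -> H h -> left_cosets H Z C -> act g (act h C) = act (g * h) C.
  move=> Hg Hh CC; have [_ /(lcoset_eq _ _ sZ) E] := cosP _ (actP _ _ Hh CC).
  by apply/(lcoset_eq _ _ sZ); rewrite invgM -!mulgA mulKg.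
have act1 C : left_cosets H Z C -> act 1 C = C.
  by case/cosP=> _ {2}<-; rewrite /act mul1g.
(* central because [h * r C] and [r (act h C)] represent the same coset *)
pose d h C := (r (act h C))^-1 * (h * r C).
have dP h C : H h -> left_cosets H Z C -> Z (d h C).
  by move=> Hh CC; have [_ /(lcoset_eq _ _ sZ)] := cosP _ (actP _ _ Hh CC).
have dM g h C :
    H g -> H h -> left_cosets H Z C -> d (g * h) C = d g (act h C) * d h C.
  by move=> Hg Hh CC; rewrite /d actM // -!mulgA; congr (_ * (_ * _));
    rewrite mulVKg.
have act_bij h : H h -> set_bij (left_cosets H Z) (left_cosets H Z) (act h).
  move=> Hh; split=> [C /(actP _ _ Hh) //|C D /set_mem CC /set_mem CD E|C CC].
    by rewrite -(act1 _ CC) -(act1 _ CD) -(mulVg h) -!actM ?E //; apply: HV.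
  exists (act h^-1 C); first by apply: actP => //; apply: HV.
  by rewrite actM ?mulgV ?act1 //; apply: HV.
exists (fun h => \sum_(C \in left_cosets H Z) s (d h C))%R.
exists (size (finmap.enum_fset (fset_set (left_cosets H Z)))).
split=> [|g h Hg Hh|z Zz].
- rewrite -has_predT; apply/hasP; exists (cos 1) => //.
  by rewrite in_fset_set //; apply: mem_set; exists 1.
- rewrite (reindex_fsbig _ _ _ (fun C => s (d g C)) (act_bij h Hh)) -fsbig_split //.
  apply: eq_fsbigr => C /set_mem CC.
  by rewrite dM // sM //; apply: dP => //; apply: actP.
- transitivity (\sum_(C \in left_cosets H Z) s z)%R.
    apply: eq_fsbigr => C /set_mem CC; congr s; have [Hr cosr] := cosP _ CC.
    rewrite /d; have -> : act z C = C.
      rewrite -{2}cosr; apply/(lcoset_eq _ _ sZ).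
      by rewrite (Zz.2 _ Hr) invgM mulgVK; exact: ZV.
    by rewrite (Zz.2 _ Hr) mulKg.
  by rewrite fsbig_finite // big_const_seq count_predT iter_addr_0.
Qed.

(** * Slopes relative to a base element *)

Section Slope.
Variables (G : groupType) (u : G).
Hypotheses (tfG : torsion_free G) (u1 : u <> 1).

(** A relation rather than a function because the two halves have different
    sources: connectedness of the graph gives existence, torsion-freeness gives
    uniqueness. *)
Definition has_slope (y : G) (q : rat) : Prop :=
  exists a b : int, [/\ b != 0%R, expgz y b = expgz u a & q = (a%:~R / b%:~R)%R].

Lemma expgz_inj : injective (expgz u).
Proof.
move=> a b eab; apply/eqP; rewrite -subr_eq0; apply: contra_notT u1.
by apply: torsion_free_expgz; rewrite // expgzD expgzN eab mulgV.
Qed.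

Lemma has_slope_uniq y q q' : has_slope y q -> has_slope y q' -> q = q'.
Proof.
move=> [a [b [b0 yb ->]]] [c [d [d0 yd ->]]].
have /expgz_inj cross : expgz u (a * d)%R = expgz u (c * b)%R.
  by rewrite !expgzM -yb -yd -!expgzM mulrC.
by apply/eqP; rewrite eqr_div ?intr_eq0 // -!intrM cross.
Qed.

Lemma has_slope1 : has_slope 1 0%R.
Proof. by exists 0%R, 1%R; split; rewrite // mul0r. Qed.

Lemma has_slope0 y : has_slope y 0%R -> y = 1.
Proof.
move=> [a [b [b0 yb /esym/eqP]]].
rewrite mulf_eq0 invr_eq0 !intr_eq0 (negPf b0) orbF => /eqP a0.
by apply: torsion_free_expgz b0; rewrite // yb a0.
Qed.

Lemma has_slopeM y z p q : commute y z ->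
  has_slope y p -> has_slope z q -> has_slope (y * z) (p + q)%R.
Proof.
move=> cyz [a [b [b0 yb ->]]] [c [d [d0 zd ->]]].
exists (a * d + c * b)%R, (b * d)%R; split; first by rewrite mulf_neq0.
  rewrite expgzMl // expgzD !expgzM yb; congr (_ * _).
  by rewrite -expgzM mulrC expgzM zd.
by rewrite addf_div ?intr_eq0 // rmorphD !rmorphM.
Qed.

Lemma has_slopeX y q n : has_slope y q -> has_slope (y ^+ n) (q *+ n)%R.
Proof.
move=> yq; elim: n => [|n IHn]; first by rewrite mulr0n; exact: has_slope1.
by rewrite expgS mulrS; apply: has_slopeM => //; apply: commuteX.
Qed.

(** The existence of slopes propagates along an edge of the power graph in both
    directions: for [z = y^k], a relation [y^b = u^a] gives [z^b = u^(a k)], and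
    [z^b = u^a] gives [y^(k b) = u^a], where [k <> 0] because [z <> 1]. *)
Lemma has_slope_power y z : z <> 1 -> is_power_of z y ->
  (exists q, has_slope y q) <-> (exists q, has_slope z q).
Proof.
move=> z1 [k zk].
have k0 : k != 0%R by apply: contra_notN z1 => /eqP k0; rewrite zk k0.
split=> -[_ [a [b [b0 e _]]]].
  exists ((a * k)%:~R / b%:~R)%R, (a * k)%R, b; split=> //.
  by rewrite zk -expgzM mulrC !expgzM e.
exists (a%:~R / (k * b)%:~R)%R, a, (k * b)%R; split=> //.
  by rewrite mulf_neq0.
by rewrite expgzM -zk.
Qed.

Definition proper_vertex x (x1 : x <> 1) : proper_power_graph G :=
  SigSub (mem_set (x1 : [set x : G | x <> 1] x)).

Lemma connected_has_slope y :
  connected_graph (proper_power_graph G) -> exists q, has_slope y q.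
Proof.
move=> conG; have [->|y1] := pselect (y = 1).
  by exists 0%R; exact: has_slope1.
have: walk (proper_vertex u1) (proper_vertex y1) by exact: conG.
suff walk_slope (v : proper_power_graph G) :
    walk (proper_vertex u1) v -> exists q, has_slope (val v) q.
  exact: walk_slope.
elim=> [|{}v w _ IH [_ vw]]; first by exists (1%:~R / 1%:~R)%R, 1%R, 1%R.
have neq1 (t : proper_power_graph G) : val t <> 1 by exact: set_mem (valP t).
by case: vw => /has_slope_power E; apply/(E (neq1 _)).
Qed.

End Slope.

(** The transfer [t] from the subgroup [<x, y>] to its center coincides with
    [n] times the slope not only on the center but on the whole subgroup,
    because a positive power of each element is central and the rationals are
    torsion-free. *)
Lemma slope_morphism (G : groupType) (u : G) (phi : G -> rat) :
  torsion_free G -> u <> 1 -> locally_center_by_finite G ->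
  (forall y, has_slope u y (phi y)) -> {morph phi : x y / x * y >-> (x + y)%R}.
Proof.
move=> tfG u1 lcfG slopeP x y.
have phiE z q : has_slope u z q -> phi z = q.
  by apply: has_slope_uniq => //; exact: slopeP.
pose H := generated [set x; y].
have sH : is_subgroup H by exact: generated_subgroup.
have finZ : finite_index H (center_of H) by apply: lcfG; exact: finite_set2.
have [||a b Za Zb|t [n [n_gt0 tM tZ]]] := @transfer G H rat phi => //.
  by apply: phiE; apply: has_slopeM => //; apply: Za.2; exact: Zb.1.
have [H1 HM HV] := is_subgroupP sH.
have tE h : H h -> t h = (phi h *+ n)%R.
  move=> Hh; have sZ := center_of_subgroup sH.
  have [m m_gt0 Zhm] := finite_index_expg sH sZ finZ Hh.
  have tX k : t (h ^+ k) = (t h *+ k)%R.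
    elim: k => [|k IHk]; last first.
      by rewrite expgS tM ?IHk ?mulrS //; apply: (subgroup_expgn _ sH).
    by apply: (@addrI _ (t 1)); rewrite -tM // mulg1 addr0.
  (* m * t h = t (h^m) = n * slope (h^m) = n * m * slope h *)
  apply: (pmulrnI m_gt0); rewrite -tX tZ // mulrnAC; congr (_ *+ _)%R.
  by apply: phiE; exact: has_slopeX.
have Hx : H x by apply: sub_gen_smallest; left.
have Hy : H y by apply: sub_gen_smallest; right.
by apply: (pmulrnI n_gt0); rewrite mulrnDl -!tE ?tM //; exact: HM.
Qed.

(** * Embeddings in the rationals *)

Section MorphismToAdditive.
Variables (G : groupType) (A : zmodType) (phi : G -> A).
Hypothesis phiM : {morph phi : x y / x * y >-> (x + y)%R}.

Lemma additive_morph1 : phi 1 = 0%R.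
Proof. by apply: (addrI (phi 1)); rewrite -phiM mulg1 addr0. Qed.

Lemma additive_morphV x : phi x^-1 = (- phi x)%R.
Proof. by apply: (addrI (phi x)); rewrite -phiM mulgV additive_morph1 subrr. Qed.

Lemma additive_morphX x n : phi (x ^+ n) = (phi x *+ n)%R.
Proof.
by elim: n => [|n IHn]; rewrite ?additive_morph1 // expgS phiM IHn mulrS.
Qed.

Lemma additive_morph_expgz x k : phi (expgz x k) = (phi x *~ k)%R.
Proof. by case: k => n; rewrite /= ?additive_morphV additive_morphX. Qed.

End MorphismToAdditive.

Lemma isomorphic_to_subgroup_ratP (G : groupType) :
  isomorphic_to_subgroup G additive_rat <->
  exists2 phi : G -> rat,
    injective phi & {morph phi : x y / x * y >-> (x + y)%R}.
Proof.
split=> [[H [f [_ [_ f_inj _]]]]|[phi phi_inj phiM]].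
  exists f; first by move=> x y; apply: f_inj; rewrite in_setT.
  exact: (@gmulfM _ _ f).
pose mix := isMultiplicative.Build G additive_rat phi phiM.
pose f : {multiplicative G -> additive_rat} := HB.pack phi mix.
exists (range f), f; split; last first.
  by split=> [x _|x y _ _ /phi_inj|_ [x _ <-]] //; exists x.
apply: is_subgroupI => [|_ _ [x _ <-] [y _ <-]|_ [x _ <-]].
- by exists 1 => //; exact: additive_morph1.
- by exists (x * y) => //; exact: phiM.
- by exists x^-1 => //; exact: additive_morphV.
Qed.

(** In a non-trivial group any non-identity element can serve as the base of the
    slopes; the trivial group has no base and is treated apart. *)
Lemma connected_embeds_rat (G : groupType) :
  torsion_free G -> locally_center_by_finite G ->
  connected_graph (proper_power_graph G) ->
  exists2 phi : G -> rat,
    injective phi & {morph phi : x y / x * y >-> (x + y)%R}.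
Proof.
move=> tfG lcfG conG.
have [[u u1]|triv] := pselect (exists u : G, u <> 1); last first.
  have G1 x : x = 1 :> G by apply: contrapT => x1; apply: triv; exists x.
  by exists (fun=> 0%R) => [x y _|x y]; rewrite ?addr0 // (G1 x) (G1 y).
have [phi slopeP] := choice (fun y => connected_has_slope u1 y conG).
have phiM := slope_morphism tfG u1 lcfG slopeP.
exists phi => // x y exy.
suff /divg1_eq : x / y = 1 by [].
apply: (@has_slope0 _ u) => //.
suff <- : phi (x / y) = 0%R by [].
by rewrite phiM exy -phiM mulgV additive_morph1.
Qed.

Lemma rat_cross_multiple (p q : rat) :
  (p *~ (numq q * denq p) = q *~ (numq p * denq q))%R.
Proof.
rewrite -(mulrzr p) -(mulrzr q) !intrM mulrCA -(numqE p).
by rewrite [RHS]mulrCA -(numqE q) mulrC.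
Qed.

Lemma walk_trans (X : simple_graph) (u v w : X) : walk u v -> walk v w -> walk u w.
Proof. by move=> uv; elim=> // v' w' _ uv' adj; exact: walk_rcons adj. Qed.

(** Vertices [x] and [y] are joined by a walk through a common power [x^k = y^l],
    where [k] and [l] are chosen so that [k * phi x = l * phi y]. *)
Lemma embeds_rat_connected (G : groupType) (phi : G -> rat) :
  injective phi -> {morph phi : x y / x * y >-> (x + y)%R} ->
  connected_graph (proper_power_graph G).
Proof.
move=> phi_inj phiM.
have phi1 := additive_morph1 phiM; have phiZ := additive_morph_expgz phiM.
have phi_neq0 x : x <> 1 -> phi x != 0%R.
  move=> x1; apply: contra_notN x1 => /eqP phix0.
  by apply: phi_inj; rewrite phix0.
pose P := proper_power_graph G.
have pow_walk (v w : P) : is_power_of (val w) (val v) -> walk v w /\ walk w v.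
  move=> pow; have [/val_inj ->|neq] := pselect (val v = val w).
    by split; exact: walk_nil.
  by split; apply: walk_rcons (walk_nil _) _; split;
     [exact: neq | left | exact: nesym | right].
move=> v w.
set x := val v; set y := val w.
have x1 : x <> 1 by exact: set_mem (valP v).
have y1 : y <> 1 by exact: set_mem (valP w).
pose k := (numq (phi y) * denq (phi x))%R.
pose l := (numq (phi x) * denq (phi y))%R.
have exy : expgz x k = expgz y l.
  by apply: phi_inj; rewrite !phiZ; exact: rat_cross_multiple.
have z1 : expgz x k <> 1.
  move/(congr1 phi); rewrite phiZ phi1 => /eqP.
  rewrite mulrz_eq0 (negPf (phi_neq0 _ x1)) orbF.
  by rewrite mulf_eq0 numq_eq0 denq_eq0 orbF (negPf (phi_neq0 _ y1)).
have [vz _] := pow_walk v (proper_vertex z1) (ex_intro _ k erefl).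
have [_ zw] := pow_walk w (proper_vertex z1) (ex_intro _ l exy).
exact: walk_trans vz zw.
Qed.

Theorem theorem10 (G : groupType) :
  torsion_free G -> locally_center_by_finite G ->
  (connected_graph (proper_power_graph G) <->
   isomorphic_to_subgroup G additive_rat).
Proof.
move=> tfG lcfG; split=> [conG|/isomorphic_to_subgroup_ratP[phi]].
  exact/isomorphic_to_subgroup_ratP/connected_embeds_rat.
exact: embeds_rat_connected.
Qed.
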